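(* Let $(g_i)_{i\in\mathbf{N}}$ be a sequence of integers such that $g_i\ge 2$ for all $i\in\mathbf{N}$, and let $\mathcal{G}$ be the British number system generated by $(g_i)_{i\in\mathbf{N}}$. Let $\mathcal{A}$ be an additive system, and for $n\in\mathbf{N}$ let $\mathcal{A}^{(n)}=(g_i)_{i\in[1,n]}\ast\mathcal{A}$ be the dilation of $\mathcal{A}$ by the finite sequence $(g_1,\ldots,g_n)$. Then \[ \lim_{n\rightarrow\infty}\mathcal{A}^{(n)}=\mathcal{G}. \]
   Context: $\mathbf{N}=\{1,2,3,\ldots\}$ and $\mathbf{N}_0=\{0,1,2,\ldots\}$. For integers $a<b$, $[a,b)=\{x\in\mathbf{Z}: a\le x<b\}$. For an integer $g$ and a set $X$ of integers, $g\ast X=\{gx:x\in X\}$. Additive system: a family $\mathcal{A}=(A_i)_{i\in I}$, indexed by a nonempty finite or infinite set $I$, of sets of nonnegative integers with $0\in A_i$ and $|A_i|\ge 2$ for all $i\in I$, such that every $n\in\mathbf{N}_0$ has a unique representation $n=\sum_{i\in I}a_i$ with $a_i\in A_i$ for all $i$ and $a_i\neq 0$ for only finitely many $i$. A set $S$ belongs to $\mathcal{A}$ if $S=A_i$ for some $i\in I$. British number system generated by $(g_i)_{i\in\mathbf{N}}$: put $G_0=1$ and $G_i=\prod_{j=1}^i g_j$; it is the additive system $(G_{i-1}\ast[0,g_i))_{i\in\mathbf{N}}$. Dilation: for an integer $g\ge2$ and an additive system $\mathcal{A}=(A_i)_{i\in I}$, the dilation $g\ast\mathcal{A}$ is the additive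 system consisting of the set $[0,g)$ (attached to a new index not in $I$) together with the sets $g\ast A_i$ for $i\in I$. The dilation by a finite sequence is defined inductively by $(g_i)_{i\in[1,1]}\ast\mathcal{A}=g_1\ast\mathcal{A}$ and $(g_i)_{i\in[1,n]}\ast\mathcal{A}=g_1\ast\left((g_i)_{i\in[2,n]}\ast\mathcal{A}\right)$; that is, $(g_i)_{i\in[1,n]}\ast\mathcal{A}=g_1\ast(g_2\ast(\cdots(g_n\ast\mathcal{A})\cdots))$. Limit: for a sequence $(\mathcal{A}^{(n)})_{n\in\mathbf{N}}$ of additive systems and an additive system $\mathcal{L}$, one writes $\lim_{n\to\infty}\mathcal{A}^{(n)}=\mathcal{L}$ if for every set $S$: $S$ belongs to $\mathcal{L}$ if and only if $S$ belongs to $\mathcal{A}^{(n)}$ for all sufficiently large $n$. *)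

(* Defs.v *)
From mathcomp Require Import all_boot finmap.
From mathcomp Require Import all_classical.

Set Implicit Arguments.
Unset Strict Implicit.
Unset Printing Implicit Defensive.

Local Open Scope classical_set_scope.

(* Sets of nonnegative integers have type [set nat].  A sequence
   (x_1, x_2, ...) indexed by the positive integers is encoded as a function on
   [nat] whose value at [i] is x_(i+1). *)

(* [\big[addn/0]_(i \in _)] is 0 by convention on families of infinite support,
   whence the separate finiteness condition. *)
Definition representation (I : choiceType) (A : I -> set nat) (n : nat)
    (a : I -> nat) : Prop :=
  [/\ forall i, A i (a i),
      finite_set [set i | a i <> 0]
    & n = \big[addn/0]_(i \in [set: I]) a i].

Record is_additive_system (I : choiceType) (A : I -> set nat) : Prop :=
  IsAdditiveSystem {
    index_nonempty : [set: I] !=set0;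
    zero_in_part : forall i, A i 0;
    card_part_ge2 : forall i, (`I_2 #<= A i)%card;
    representation_unique :
      forall n, exists! a : I -> nat, representation A n a
  }.

(* With classical axioms every type is a choiceType: the index set is
   arbitrary. *)
Record additive_system := AdditiveSystem {
  index : choiceType;
  part : index -> set nat;
  additive_systemP : is_additive_system part
}.

Definition belongs (S : set nat) (A : additive_system) : Prop :=
  exists i : index A, S = part i.

Definition scale (g : nat) (X : set nat) : set nat := muln g @` X.

Lemma card_scale (g : nat) (X : set nat) :
  0 < g -> (`I_2 #<= X)%card -> (`I_2 #<= scale g X)%card.
Proof.
move=> g0 X2; rewrite (card_le_eqr (B := X)) //.
by apply: inj_card_eq => x y _ _ /eqP; rewrite eqn_pmul2l // => /eqP.
Qed.

Lemma finite_support_fset (I : choiceType) (b : I -> nat) :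
  finite_set [set i | b i <> 0] ->
  exists X : {fset I}, forall i, i \notin X -> b i = 0.
Proof.
move=> /finite_fsetP[X eX]; exists X => i.
by apply: contraNeq => /eqP bi; have : [set` X] i by rewrite -eX.
Qed.

Lemma big_option (I : choiceType) (b : option I -> nat) :
  finite_set [set j | b j <> 0] ->
  \big[addn/0]_(j \in [set: option I]) b j =
  b None + \big[addn/0]_(i \in [set: I]) b (Some i).
Proof.
move=> /finite_support_fset[X bX].
pose Y := [fset i in pmap id X]%fset.
have bY i : i \notin Y -> b (Some i) = 0.
  move=> iY; apply: bX; apply: contra iY => iX.
  by rewrite inE /= mem_pmap; apply/mapP; exists (Some i).
rewrite (fsbigTE Y) // (fsbigTE (None |` [fset Some i | i in Y])%fset); last first.
  move=> [i|]; rewrite !inE //= => iY; apply: bY; apply: contra iY => iY.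
  by apply/imfsetP; exists i.
rewrite big_fsetU1 /=; last by apply/negP => /imfsetP[].
by rewrite big_imfset //= => i j _ _ [].
Qed.

Lemma big_scale (I : choiceType) (g : nat) (a : I -> nat) :
  finite_set [set i | a i <> 0] ->
  \big[addn/0]_(i \in [set: I]) (g * a i) =
  g * \big[addn/0]_(i \in [set: I]) a i.
Proof.
move=> /finite_support_fset[X aX].
rewrite (fsbigTE X) => [|i /aX ->]; last by rewrite muln0.
by rewrite (fsbigTE X) // big_distrr.
Qed.

Definition dilation_part (g : nat) (I : choiceType) (A : I -> set nat)
    (j : option I) : set nat :=
  if j is Some i then scale g (A i) else `I_g.

Lemma dilation_is_additive_system (g : nat) (I : choiceType)
    (A : I -> set nat) :
  2 <= g -> is_additive_system A -> is_additive_system (dilation_part g A).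
Proof.
move=> g2 [_ A0 A2 Arep]; have g0 : 0 < g by apply: leq_trans g2.
split.
- by exists None.
- by move=> [i|] //=; exists 0; rewrite ?muln0.
- by move=> [i|] /=; [apply: card_scale | rewrite card_le_II].
move=> n; have [a [[aA afin asum] auniq]] := Arep (n %/ g).
exists (fun j => if j is Some i then g * a i else n %% g); split.
  set b := fun j => _.
  have bfin : finite_set [set j | b j <> 0].
    apply: (@sub_finite_set _ _ (None |` Some @` [set i | a i <> 0])).
      move=> [i|] /= bj; [right; exists i => // ai0 | by left].
      by apply: bj; rewrite /b ai0 muln0.
    by rewrite finite_setU; split; [exact: finite_set1 | exact: finite_image].
  split=> //.
    by move=> [i|] /=; [exists (a i) | rewrite ltn_mod].
  by rewrite big_option // big_scale // -asum addnC mulnC -divn_eq.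
move=> b [bA bfin bsum].
have /choice[c cP] : forall i, exists x, A i x /\ g * x = b (Some i).
  by move=> i; have [x ? ?] := bA (Some i); exists x.
have cfin : finite_set [set i | c i <> 0].
  apply: (@sub_finite_set _ _ (Some @^-1` [set j | b j <> 0])).
    move=> i /= /eqP ci; rewrite -(cP i).2; apply/eqP.
    by rewrite muln_eq0 negb_or ci -lt0n g0.
  by apply: finite_preimage => // x y _ _ [].
have bg : b None < g := bA None.
have nE : n = (\big[addn/0]_(i \in [set: I]) c i) * g + b None.
  rewrite bsum big_option // addnC; congr (_ + _); rewrite mulnC -big_scale //.
  by apply: eq_fsbigr => i _; rewrite (cP i).2.
have ac : a = c.
  apply: auniq; split=> //; first by move=> i; exact: (cP i).1.
  by rewrite nE divnMDl // divn_small // addn0.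
apply: funext => -[i|]; first by rewrite ac (cP i).2.
by rewrite nE modnMDl modn_small.
Qed.

Definition dilation (g : nat) (hg : 2 <= g) (A : additive_system) :
    additive_system :=
  AdditiveSystem (dilation_is_additive_system hg (additive_systemP A)).

(* [dilation_seq hg n A] is g_1 * (g_2 * ( ... (g_n * A) ... )); the empty
   sequence of factors, n = 0, gives A. *)
Fixpoint dilation_seq (g : nat -> nat) (hg : forall i, 2 <= g i) (n : nat)
    (A : additive_system) : additive_system :=
  if n is m.+1 then
    dilation (hg 0) (dilation_seq (g := fun i => g i.+1)
                       (fun i => hg i.+1) m A)
  else A.

(* G_i = g_1 * ... * g_i, where g_(j+1) = g j *)
Definition radix_prod (g : nat -> nat) (i : nat) : nat := \prod_(j < i) g j.

(* The value at [i] is G_i * [0, g_(i+1)). *)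
Definition british_part (g : nat -> nat) (i : nat) : set nat :=
  scale (radix_prod g i) `I_(g i).

Lemma radix_prodS (g : nat -> nat) (i : nat) :
  radix_prod g i.+1 = radix_prod g i * g i.
Proof. exact: big_ord_recr. Qed.

Lemma radix_prod_dvd (g : nat -> nat) (i j : nat) :
  i <= j -> radix_prod g i %| radix_prod g j.
Proof.
move=> /subnKC <-; elim: (j - i) => [|k IH]; first by rewrite addn0.
by rewrite addnS radix_prodS dvdn_mulr.
Qed.

Lemma radix_prod_gt (g : nat -> nat) (i : nat) :
  (forall i, 2 <= g i) -> i < radix_prod g i.
Proof.
move=> hg; elim: i => [|i IH]; first by rewrite /radix_prod big_ord0.
rewrite radix_prodS; apply: (leq_ltn_trans IH).
by rewrite ltn_Pmulr // (leq_trans _ IH).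
Qed.

Lemma big_bounded_support (b : nat -> nat) (N : nat) :
  (forall i, N <= i -> b i = 0) ->
  \big[addn/0]_(i \in [set: nat]) b i = \sum_(i < N) b i.
Proof.
move=> bN; rewrite fsbig_ord; apply/esym/fsbig_widen => // i [_ /= /negP].
by rewrite -leqNgt => /bN.
Qed.

Lemma bounded_support (b : nat -> nat) :
  finite_set [set i | b i <> 0] -> exists N, forall i, N <= i -> b i = 0.
Proof.
move=> /finite_support_fset[X bX]; exists (\sum_(i <- X) i).+1 => i Ni.
apply: bX; apply: contraL Ni => iX.
by rewrite -ltnNge ltnS (big_rem i) //= leq_addr.
Qed.

Lemma radix_partial_sum (g b : nat -> nat) (n M k : nat) :
  (forall i, british_part g i (b i)) -> n = \sum_(i < M) b i -> k <= M ->
  \sum_(i < k) b i = n %% radix_prod g k.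
Proof.
move=> bB -> kM.
have lt_sum : \sum_(i < k) b i < radix_prod g k.
  elim: k {kM} => [|k IH]; first by rewrite /radix_prod !big_ord0.
  rewrite big_ord_recr radix_prodS /=; have [d /= dg <-] := bB k.
  by rewrite (leq_trans (n := radix_prod g k * d.+1)) ?leq_mul2l ?dg ?orbT //
    mulnS ltn_add2r.
have -> : \sum_(i < M) b i = \sum_(i < k) b i + \sum_(k <= i < M) b i.
  by rewrite -!(big_mkord xpredT b) -big_cat_nat.
have /dvdnP[q ->] : radix_prod g k %| \sum_(k <= i < M) b i.
  rewrite big_seq; apply: dvdn_sum => i; rewrite mem_index_iota => /andP[ki _].
  by have [d _ <-] := bB i; rewrite dvdn_mulr // radix_prod_dvd.
by rewrite addnC modnMDl modn_small.
Qed.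

Lemma british_is_additive_system (g : nat -> nat) :
  (forall i, 2 <= g i) -> is_additive_system (british_part g).
Proof.
move=> hg.
have g0 i : 0 < g i by apply: leq_trans (hg i).
have G0 i : 0 < radix_prod g i by apply: leq_ltn_trans (radix_prod_gt i hg).
split.
- by exists 0.
- by move=> i; exists 0; rewrite ?muln0 //=.
- by move=> i; apply: card_scale; rewrite ?card_le_II.
move=> n.
pose a i := radix_prod g i * ((n %/ radix_prod g i) %% g i).
have aN i : n <= i -> a i = 0.
  move=> ni; rewrite /a divn_small ?mod0n ?muln0 //.
  exact: leq_ltn_trans ni (radix_prod_gt i hg).
have asum k : \sum_(i < k) a i = n %% radix_prod g k.
  elim: k => [|k IH]; first by rewrite /radix_prod !big_ord0 modn1.
  rewrite big_ord_recr /= IH radix_prodS /a modn_divl mulnC.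
  set G := radix_prod g k; rewrite [RHS](divn_eq _ G) addnC; congr (_ + _).
    by rewrite (mulnC G).
  by rewrite modn_dvdm // dvdn_mulr.
exists a; split.
  split.
  - by move=> i; exists ((n %/ radix_prod g i) %% g i) => //=; rewrite ltn_mod.
  - apply: (@sub_finite_set _ _ `I_n) => // i /= ai.
    by rewrite ltnNge; apply/negP => /aN.
  - by rewrite (big_bounded_support aN) asum modn_small // radix_prod_gt.
move=> b [bB bfin bsum]; have [N bN] := bounded_support bfin.
apply: funext => k; pose M := maxn N k.+1.
have nE : n = \sum_(i < M) b i.
  rewrite bsum; apply: big_bounded_support => i; rewrite geq_max => /andP[Ni _].
  exact: bN.
have kM : k.+1 <= M by rewrite leq_maxr.
have := radix_partial_sum bB nE kM; rewrite -asum !big_ord_recr /=.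
by rewrite (radix_partial_sum bB nE (ltnW kM)) -asum => /addnI.
Qed.

Definition british_number_system (g : nat -> nat) (hg : forall i, 2 <= g i) :
    additive_system :=
  AdditiveSystem (british_is_additive_system hg).

Definition is_limit (A : nat -> additive_system) (L : additive_system) : Prop :=
  forall S : set nat, belongs S L <-> \forall n \near \oo, belongs S (A n).

(* Main.v *)
(* Dilating by g_1, ..., g_n produces the first n members G_(i-1) * [0, g_i) of
   the British system together with the sets G_n * A_i.  A member of any
   additive system contains some x > 0, which cannot be a multiple of G_n once
   G_n > x; so a set belonging to the dilations for all large n is a member of
   the British system. *)
Require Import Defs.
From mathcomp Require Import all_boot all_classical.

Local Open Scope classical_set_scope.

Lemma scale_scale (g h : nat) (X : set nat) :
  scale g (scale h X) = scale (g * h) X.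
Proof.
by rewrite /scale image_comp; congr image; apply/funext => x /=; rewrite mulnA.
Qed.

Lemma scale1 (X : set nat) : scale 1 X = X.
Proof.
by apply/seteqP; split=> [_ [x Xx <-]|x Xx]; [|exists x]; rewrite ?mul1n.
Qed.

(** [dilation_seq] recurses on the first factor, so the product is split on the left, leaving the
    shifted sequence. *)
Lemma radix_prod_recl (g : nat -> nat) (n : nat) :
  radix_prod g n.+1 = g 0 * radix_prod (fun i => g i.+1) n.
Proof. exact: big_ord_recl. Qed.

Lemma british_part0 (g : nat -> nat) : british_part g 0 = `I_(g 0).
Proof. by rewrite /british_part /radix_prod big_ord0 scale1. Qed.

Lemma british_partS (g : nat -> nat) (i : nat) :
  british_part g i.+1 = scale (g 0) (british_part (fun i => g i.+1) i).
Proof. by rewrite /british_part scale_scale radix_prod_recl. Qed.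

Lemma belongs_dilation (g : nat) (hg : 2 <= g) (A : additive_system)
    (S : set nat) :
  belongs S (dilation hg A) <->
  S = `I_g \/ exists2 T, belongs T A & S = scale g T.
Proof.
split=> [[[i|] ->]|[->|[_ [i ->] ->]]]; last 2 first.
- by exists None.
- by exists (Some i).
- by right; exists (part i) => //; exists i.
- by left.
Qed.

(** Induction on [n] for all [g], since the inner dilation uses the shifted sequence; the outer one
    adds British part 0 and turns part [i] of the shifted system into part [i.+1]. *)
Lemma belongs_dilation_seq (g : nat -> nat) (hg : forall i, 2 <= g i) (n : nat)
    (A : additive_system) (S : set nat) :
  belongs S (dilation_seq hg n A) <->
  (exists2 i, i < n & S = british_part g i) \/
  (exists2 T, belongs T A & S = scale (radix_prod g n) T).
Proof.
elim: n g hg S => [|n IH] g hg S.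
  rewrite /radix_prod big_ord0 /=; split=> [AS|[[]//|[T AT ->]]].
    by right; exists S; rewrite ?scale1.
  by rewrite scale1.
split.
  move=> /belongs_dilation[->|[T /IH[[i lt_in ->]|[U AU ->]] ->]].
  - by left; exists 0; rewrite ?british_part0.
  - by left; exists i.+1; rewrite ?british_partS.
  - by right; exists U; rewrite // scale_scale radix_prod_recl.
move=> [[[_ ->|i lt_in ->]]|[T AT ->]]; apply/belongs_dilation.
- by left; rewrite british_part0.
- right; exists (british_part (fun i => g i.+1) i); last exact: british_partS.
  by apply/IH; left; exists i.
- right; exists (scale (radix_prod (fun i => g i.+1) n) T).
    by apply/IH; right; exists T.
  by rewrite scale_scale radix_prod_recl.
Qed.

Lemma belongs_pos (A : additive_system) (S : set nat) :
  belongs S A -> exists2 x, S x & 0 < x.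
Proof.
move=> [i ->]; apply: contrapT => noX.
(* Without a positive element the part would lie in {0}, that is, in [I_1]. *)
suff : (`I_2 #<= `I_1)%card by rewrite card_le_II.
apply: card_le_trans (card_part_ge2 (additive_systemP A) i) _.
apply: subset_card_le => x Ax /=; rewrite ltnS leqNgt; apply/negP => x0.
by apply: noX; exists x.
Qed.

Theorem theorem6 (g : nat -> nat) (hg : forall i : nat, 2 <= g i)
    (A : additive_system) :
  is_limit (fun n : nat => dilation_seq hg n.+1 A) (british_number_system hg).
Proof.
move=> S; split=> [[i ->]|[N _ SN]].
  (* The term at [n] uses [n.+1] factors, so the threshold [i] suffices. *)
  by exists i => // n le_in; apply/belongs_dilation_seq; left; exists i.
have [x Sx x_gt0] : exists2 x, S x & 0 < x := belongs_pos _ _ (SN N (leqnn N)).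
(* Index [maxn N x] is late enough for [SN] and makes the product of the factors exceed [x]. *)
have /belongs_dilation_seq[[i _ ->]|[T _ defS]] := SN (maxn N x) (leq_maxl _ _).
  by exists i.
move: Sx; rewrite defS => -[y _ def_x].
have := dvdn_mulr y (dvdnn (radix_prod g (maxn N x).+1)).
rewrite def_x => /(dvdn_leq x_gt0).
rewrite leqNgt (leq_ltn_trans _ (radix_prod_gt _ hg)) //.
by rewrite leqW // leq_maxr.
Qed.
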